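(* Let $(X,\mathcal{R}_\mu,\mu)$ and $(Y,\mathcal{R}_\nu,\nu)$ be probability spaces (with values in a complete non-Archimedean valued field $K$), and let $T:X\to X$ and $S:Y\to Y$ be measure preserving transformations. If $T$ and $S$ are conjugate, then their measure-theoretic entropies agree: $h_\mu(T)=h_\nu(S)$.
   Context: Let $K$ be a complete non-Archimedean valued field with absolute value $|\cdot|$. For a set $X$, a covering ring is a collection $\mathcal{R}\subseteq\mathcal{P}(X)$ that covers $X$ and is closed under $A\cap B$, $A\cup B$, $A\setminus B$. It is separating if for all distinct $x,y\in X$ there is $A\in\mathcal{R}$ with $x\in A$, $y\notin A$; it is an algebra if $X\in\mathcal{R}$. All covering rings are assumed separating. The $\mathcal{R}$-topology is the topology on $X$ with basis $\mathcal{R}$. A subcollection $\mathcal{A}\subset\mathcal{R}$ is shrinking if the intersection of any two elements of $\mathcal{A}$ contains an element of $\mathcal{A}$. A measure is a map $\mu:\mathcal{R}\to K$ that is additive on disjoint sets, bounded (for every $A\in\mathcal{R}$ the set $\{\mu(B):B\in\mathcal{R},B\subset A\}$ is bounded), and continuous (if $\mathcal{A}\subset\mathcal{R}$ is shrinking with $\bigcap_{A\in\mathcal{A}}A=\emptyset$, then for every $\epsilon>0$ there is $A_0\in\mathcal{A}$ with $|\mu(A)|<\epsilon$ for every $A\in\mathcal{A}$ contained in $A_0$). Put $N_\mu(x)=\inf\{\sup\{|\mu(B)|:B\in\mathcal{R},B\subset U\}:U\in\mathcal{R},x\in U\}$. For $f:X\to K$ put $\|f\|_\mu=\sup_{x\in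 X}|f(x)|N_\mu(x)$. Step functions are finite $K$-linear combinations of indicator functions $\chi_A$, $A\in\mathcal{R}$; the integral is the linear functional on step functions with $\int\chi_A\,d\mu=\mu(A)$; $f$ is integrable if there are step functions $f_n$ with $\|f_n-f\|_\mu\to0$, and the integral extends by continuity. $\mathcal{R}_\mu$ is the collection of sets $A\subset X$ with $\chi_A$ integrable; it is a covering ring containing $\mathcal{R}$ and $\mu$ extends to it by $\mu(A)=\int\chi_A\,d\mu$. For $A\in\mathcal{R}_\mu$, $\|A\|_\mu=\sup\{|\mu(B)|:B\in\mathcal{R}_\mu,B\subset A\}$. The triple $(X,\mathcal{R}_\mu,\mu)$ is a probability space if $\mathcal{R}$ is an algebra and $\mu(X)=1$. A measure preserving transformation is a map $T:X\to X$ that is continuous for the $\mathcal{R}_\mu$-topology and satisfies $\mu(T^{-1}B)=\mu(B)$ for all $B\in\mathcal{R}_\mu$. A measure algebra isomorphism $\Phi:(\mathcal{R}_\mu,\mu)\to(\mathcal{R}_\nu,\nu)$ is a bijection $\mathcal{R}_\mu\to\mathcal{R}_\nu$ preserving complements and unions with $\nu(\Phi(B))=\mu(B)$ for all $B\in\mathcal{R}_\mu$. $T$ and $S$ are conjugate if there is such a $\Phi$ with $\Phi^{-1}\circ S^{-1}=T^{-1}\circ\Phi^{-1}$ (where $T^{-1},S^{-1}$ denote taking preimages of sets). Entropy (logarithms in base 2). A partition is a collection of disjoint elements of $\mathcal{R}_\mu$ covering $X$. Finite subalgebras $\mathcal{A}$ of $\mathcal{R}_\mu$ correspond to finite partitions: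 if $\mathcal{A}=\{C_1,\dots,C_k\}$, then $\alpha(\mathcal{A})$ is the partition into the nonempty sets $B_1\cap\dots\cap B_k$ with each $B_i\in\{C_i,X\setminus C_i\}$. For partitions, $\alpha\vee\beta=\{A\cap B:A\in\alpha,B\in\beta\}$, and $\mathcal{A}\vee\mathcal{B}$ is the finite subalgebra with $\alpha(\mathcal{A}\vee\mathcal{B})=\alpha(\mathcal{A})\vee\alpha(\mathcal{B})$. For a finite partition $\alpha$, $\mathcal{M}(\alpha)=\{A\in\alpha:\|A\|_\mu>0\}$ and $M(\alpha)=\#\mathcal{M}(\alpha)$. Put $H_\mu(\mathcal{A})=\min_{A\in\mathcal{M}(\alpha(\mathcal{A}))}\|A\|_\mu\cdot\log M(\alpha(\mathcal{A}))$, $h_\mu(T,\mathcal{A})=\lim_{n\to\infty}\frac1n H_\mu(\mathcal{A}\vee T^{-1}\mathcal{A}\vee\dots\vee T^{-(n-1)}\mathcal{A})$, and $h_\mu(T)=\sup_{\mathcal{A}}h_\mu(T,\mathcal{A})$, the supremum over all finite subalgebras $\mathcal{A}$ of $\mathcal{R}_\mu$. *)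

(* Defs.v *)
From HB Require Import structures.
From mathcomp Require Import all_boot all_order all_algebra finmap.
From mathcomp Require Import all_classical all_reals all_analysis.

Set Implicit Arguments.
Unset Strict Implicit.
Unset Printing Implicit Defensive.

Import Order.TTheory GRing.Theory Num.Theory.
Import numFieldNormedType.Exports.

Local Open Scope classical_set_scope.
Local Open Scope ring_scope.

Record complete_nonarch_absval (R : realType) (K : fieldType) (v : K -> R)
    : Prop := CompleteNonarchAbsval {
  absval_ge0 : forall x, 0 <= v x;
  absval_eq0 : forall x, v x = 0 <-> x = 0;
  absvalM : forall x y, v (x * y) = v x * v y;
  absval_ultra : forall x y, v (x + y) <= Num.max (v x) (v y);
  absval_complete : forall u : nat -> K,
    (forall e : R, 0 < e -> exists N : nat, forall m n : nat,
       (N <= m)%N -> (N <= n)%N -> v (u m - u n) < e) ->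
    exists l : K, (fun n => v (u n - l)) @ \oo --> (0 : R) }.

Record covering_ring (X : Type) (Rg : set (set X)) : Prop := CoveringRing {
  ring_cover : \bigcup_(A in Rg) A = setT;
  ring_setI : forall A B, Rg A -> Rg B -> Rg (A `&` B);
  ring_setU : forall A B, Rg A -> Rg B -> Rg (A `|` B);
  ring_setD : forall A B, Rg A -> Rg B -> Rg (A `\` B) }.

Definition separating (X : Type) (Rg : set (set X)) : Prop :=
  forall x y : X, x <> y -> exists A, [/\ Rg A, A x & ~ A y].

Definition ring_open (X : Type) (Rg : set (set X)) (U : set X) : Prop :=
  exists2 D : set (set X), D `<=` Rg & U = \bigcup_(A in D) A.

Definition shrinking (X : Type) (D : set (set X)) : Prop :=
  forall A B, D A -> D B -> exists2 C, D C & C `<=` A `&` B.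

(* A measure on Rg is represented by a total function on set X; only its values
   on Rg matter. *)
Record is_measure (R : realType) (K : fieldType) (v : K -> R) (X : Type)
    (Rg : set (set X)) (mu : set X -> K) : Prop := IsMeasure {
  measure_additive : forall A B, Rg A -> Rg B -> A `&` B = set0 ->
    mu (A `|` B) = mu A + mu B;
  measure_bounded : forall A, Rg A ->
    has_ubound [set v (mu B) | B in [set B | Rg B /\ B `<=` A]];
  measure_continuous : forall D : set (set X), D `<=` Rg -> shrinking D ->
    \bigcap_(A in D) A = set0 -> forall e : R, 0 < e ->
    exists2 A0, D A0 & forall A, D A -> A `<=` A0 -> v (mu A) < e }.

(* sup {|mu B| : B in Rg, B included in A}; the set is bounded when mu is a
   measure on Rg and A is in Rg, so that the real-valued sup is meaningful. *)
Definition mnorm (R : realType) (K : fieldType) (v : K -> R) (X : Type)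
    (Rg : set (set X)) (mu : set X -> K) (A : set X) : R :=
  sup [set v (mu B) | B in [set B | Rg B /\ B `<=` A]].

Definition Nmu (R : realType) (K : fieldType) (v : K -> R) (X : Type)
    (Rg : set (set X)) (mu : set X -> K) (x : X) : R :=
  inf [set mnorm v Rg mu U | U in [set U | Rg U /\ U x]].

Definition fnorm (R : realType) (K : fieldType) (v : K -> R) (X : Type)
    (Rg : set (set X)) (mu : set X -> K) (f : X -> K) : \bar R :=
  ereal_sup (range (fun x => (v (f x) * Nmu v Rg mu x)%:E)).

(* A step function is given by the list s of the pairs (c, A) of one of its
   expressions as a linear combination of indicators. *)
Definition is_step (K : fieldType) (X : Type) (Rg : set (set X))
    (s : seq (K * set X)) : Prop :=
  forall p, p \in s -> Rg p.2.

Definition step_fun (K : fieldType) (X : Type) (s : seq (K * set X))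
    : X -> K :=
  fun x => \sum_(p <- s) p.1 * \1_(p.2) x.

Definition step_integral (K : fieldType) (X : Type) (mu : set X -> K)
    (s : seq (K * set X)) : K :=
  \sum_(p <- s) p.1 * mu p.2.

Definition step_approx (R : realType) (K : fieldType) (v : K -> R) (X : Type)
    (Rg : set (set X)) (mu : set X -> K) (f : X -> K)
    (s : nat -> seq (K * set X)) : Prop :=
  (forall n, is_step Rg (s n)) /\
  (fun n => fnorm v Rg mu (fun x => step_fun (s n) x - f x)) @ \oo --> 0%E.

Definition is_integrable (R : realType) (K : fieldType) (v : K -> R) (X : Type)
    (Rg : set (set X)) (mu : set X -> K) (f : X -> K) : Prop :=
  exists s, step_approx v Rg mu f s.

(* I is the limit of the integrals of step functions converging to f. *)
Definition is_integral (R : realType) (K : fieldType) (v : K -> R) (X : Type)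
    (Rg : set (set X)) (mu : set X -> K) (f : X -> K) (I : K) : Prop :=
  exists2 s, step_approx v Rg mu f s &
    (fun n => v (step_integral mu (s n) - I)) @ \oo --> (0 : R).

Definition integral_of (R : realType) (K : fieldType) (v : K -> R) (X : Type)
    (Rg : set (set X)) (mu : set X -> K) (f : X -> K) : K :=
  xget 0 (is_integral v Rg mu f).

(* R_mu in the usual notation. *)
Definition ext_ring (R : realType) (K : fieldType) (v : K -> R) (X : Type)
    (Rg : set (set X)) (mu : set X -> K) : set (set X) :=
  [set A | is_integrable v Rg mu (\1_A)].

Definition ext_measure (R : realType) (K : fieldType) (v : K -> R) (X : Type)
    (Rg : set (set X)) (mu : set X -> K) (A : set X) : K :=
  integral_of v Rg mu (\1_A).

(* ||A||_mu: the sup is over sets of R_mu, not only of Rg. *)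
Definition set_norm (R : realType) (K : fieldType) (v : K -> R) (X : Type)
    (Rg : set (set X)) (mu : set X -> K) (A : set X) : R :=
  mnorm v (ext_ring v Rg mu) (ext_measure v Rg mu) A.

Record probability_space (R : realType) (K : fieldType) (v : K -> R)
    (X : Type) (Rg : set (set X)) (mu : set X -> K) : Prop :=
  ProbabilitySpace {
  prob_ring : covering_ring Rg;
  prob_separating : separating Rg;
  prob_algebra : Rg setT;
  prob_measure : is_measure v Rg mu;
  prob_total : mu setT = 1 }.

(* The extended measure is only defined on R_mu, hence the first conjunct of
   mp_measure: mu (T^-1 B) presupposes that T^-1 B is in R_mu. *)
Record measure_preserving (R : realType) (K : fieldType) (v : K -> R)
    (X : Type) (Rg : set (set X)) (mu : set X -> K) (T : X -> X) : Prop :=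
  MeasurePreserving {
  mp_continuous : forall U, ring_open (ext_ring v Rg mu) U ->
    ring_open (ext_ring v Rg mu) (T @^-1` U);
  mp_measure : forall B, ext_ring v Rg mu B ->
    ext_ring v Rg mu (T @^-1` B) /\
    ext_measure v Rg mu (T @^-1` B) = ext_measure v Rg mu B }.

Record measure_algebra_iso (R : realType) (K : fieldType) (v : K -> R)
    (X Y : Type) (RX : set (set X)) (mu : set X -> K)
    (RY : set (set Y)) (nu : set Y -> K) (Phi : set X -> set Y) : Prop :=
  MeasureAlgebraIso {
  iso_bij : set_bij (ext_ring v RX mu) (ext_ring v RY nu) Phi;
  iso_setC : forall A, ext_ring v RX mu A -> Phi (~` A) = ~` Phi A;
  iso_setU : forall A B, ext_ring v RX mu A -> ext_ring v RX mu B ->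
    Phi (A `|` B) = Phi A `|` Phi B;
  iso_measure : forall B, ext_ring v RX mu B ->
    ext_measure v RY nu (Phi B) = ext_measure v RX mu B }.

(* Psi is the inverse of the bijection Phi from R_mu to R_nu. *)
Definition conjugate (R : realType) (K : fieldType) (v : K -> R)
    (X Y : Type) (RX : set (set X)) (mu : set X -> K) (T : X -> X)
    (RY : set (set Y)) (nu : set Y -> K) (S : Y -> Y) : Prop :=
  exists (Phi : set X -> set Y) (Psi : set Y -> set X),
    [/\ measure_algebra_iso v RX mu RY nu Phi,
        forall A, ext_ring v RX mu A -> Psi (Phi A) = A,
        forall C, ext_ring v RY nu C ->
          ext_ring v RX mu (Psi C) /\ Phi (Psi C) = C &
        forall C, ext_ring v RY nu C ->
          Psi (S @^-1` C) = T @^-1` (Psi C)].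

Definition finite_subalgebra (X : Type) (Rg : set (set X))
    (A : set (set X)) : Prop :=
  [/\ finite_set A, A `<=` Rg, A setT,
      forall C, A C -> A (~` C) & forall C D, A C -> A D -> A (C `|` D)].

(* alpha(A): the nonempty intersections of sets B C, C in A, where B C is
   either C or its complement. *)
Definition alpha (X : Type) (A : set (set X)) : set (set X) :=
  [set P | P !=set0 /\ exists2 B : set X -> set X,
     (forall C, A C -> B C = C \/ B C = ~` C) & P = \bigcap_(C in A) B C].

Definition partition_join (X : Type) (a b : set (set X)) : set (set X) :=
  [set P `&` Q | P in a & Q in b].

(* The algebra of all unions of members of alpha(A) \/ alpha(B); see
   alpha_algebra_join below. *)
Definition algebra_join (X : Type) (A B : set (set X)) : set (set X) :=
  [set C | exists2 D : set (set X),
     D `<=` partition_join (alpha A) (alpha B) & C = \bigcup_(P in D) P].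

Definition preimage_algebra (X : Type) (T : X -> X) (i : nat)
    (A : set (set X)) : set (set X) :=
  [set iter i T @^-1` C | C in A].

(* A \/ T^-1 A \/ ... \/ T^-(n-1) A; the trivial algebra is neutral for
   algebra_join. *)
Definition iterated_join (X : Type) (T : X -> X) (A : set (set X)) (n : nat)
    : set (set X) :=
  \big[@algebra_join X/[set set0; setT]]_(i < n) preimage_algebra T i A.

Definition log2 (R : realType) (x : R) : R := ln x / ln 2.

Definition nonnull (R : realType) (K : fieldType) (v : K -> R) (X : Type)
    (Rg : set (set X)) (mu : set X -> K) (a : set (set X)) : set (set X) :=
  [set P | a P /\ 0 < set_norm v Rg mu P].

(* The inf is a min, as alpha(A) is finite; the set nonnull (alpha A) is
   nonempty on a probability space. *)
Definition Hentropy (R : realType) (K : fieldType) (v : K -> R) (X : Type)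
    (Rg : set (set X)) (mu : set X -> K) (A : set (set X)) : R :=
  inf [set set_norm v Rg mu P | P in nonnull v Rg mu (alpha A)] *
  log2 (#|` fset_set (nonnull v Rg mu (alpha A))|%:R).

Definition entropy_of (R : realType) (K : fieldType) (v : K -> R) (X : Type)
    (Rg : set (set X)) (mu : set X -> K) (T : X -> X) (A : set (set X)) : R :=
  lim ((fun n : nat => n%:R^-1 * Hentropy v Rg mu (iterated_join T A n))
         @ \oo).

Definition entropy (R : realType) (K : fieldType) (v : K -> R) (X : Type)
    (Rg : set (set X)) (mu : set X -> K) (T : X -> X) : \bar R :=
  ereal_sup [set (entropy_of v Rg mu T A)%:E |
             A in finite_subalgebra (ext_ring v Rg mu)].

Definition atom (X : Type) (A : set (set X)) (x : X) : set X :=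
  [set y | forall C, A C -> (C x <-> C y)].

Lemma alphaE (X : Type) (A : set (set X)) : alpha A = range (atom A).
Proof.
apply/seteqP; split => [P [[x Px] [B AB PE]]|P [x _ <-]].
  exists x => //; apply/seteqP; split => y; rewrite PE in Px *.
    move=> xy C hC; have := Px C hC; case: (AB C hC) => ->; first by move/(xy C hC).
    by move=> nCx Cy; apply: nCx; apply/(xy C hC).
  move=> Py C hC; have := Py C hC; have := Px C hC.
  by case: (AB C hC) => ->.
split; first by exists x.
exists (fun C => if pselect (C x) then C else ~` C).
  by move=> C _; case: pselect; [left|right].
apply/seteqP; split => y.
  move=> xy C hC; case: pselect => [/(xy C hC)//|nCx Cy].
  by apply: nCx; apply/(xy C hC).
by move=> Py C hC; have := Py C hC; case: pselect => //; split.
Qed.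

Lemma alpha_algebra_join (X : Type) (A B : set (set X)) :
  alpha (algebra_join A B) =
  partition_join (alpha A) (alpha B) `\ set0.
Proof.
have atomJ x : atom (algebra_join A B) x = atom A x `&` atom B x.
  apply/seteqP; split => y.
    move=> xy; have : (atom A x `&` atom B x) y.
      apply/xy; last by split.
      exists [set atom A x `&` atom B x]; last by rewrite bigcup_set1.
      move=> _ ->; rewrite !alphaE; exists (atom A x); first by exists x.
      by exists (atom B x) => //; exists x.
    by [].
  move=> [Axy Bxy] _ [D DJ ->].
  suff H P : D P -> P x <-> P y by split=> -[P DP Pz]; exists P => //; apply/(H P DP).
  move=> /DJ; rewrite !alphaE => -[_ [a _ <-] [_ [b _ <-] <-]].
  split=> -[Pa Pb]; split => C Cin.
  - by have := Pa _ Cin; have := Axy _ Cin; tauto.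
  - by have := Pb _ Cin; have := Bxy _ Cin; tauto.
  - by have := Pa _ Cin; have := Axy _ Cin; tauto.
  - by have := Pb _ Cin; have := Bxy _ Cin; tauto.
rewrite !alphaE; apply/seteqP; split => P.
  move=> [x _ <-]; rewrite atomJ; split.
    by exists (atom A x); [exists x|exists (atom B x) => //; exists x].
  by apply/eqP/set0P; exists x; split.
move=> [[_ [a _ <-] [_ [b _ <-] PE]] /eqP/set0P[x Px]].
exists x => //; rewrite atomJ -PE; rewrite -PE in Px; case: Px => Pa Pb.
apply/seteqP; split => y [ya yb]; split => C Cin.
- by have := Pa _ Cin; have := ya _ Cin; tauto.
- by have := Pb _ Cin; have := yb _ Cin; tauto.
- by have := Pa _ Cin; have := ya _ Cin; tauto.
- by have := Pb _ Cin; have := yb _ Cin; tauto.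
Qed.

(* Main.v *)
(** R_mu is an algebra of sets and Phi is an isomorphism of algebras of sets.
    Everything entering the entropy is determined by this structure: the
    partition of a finite subalgebra consists of its minimal nonempty members,
    the join of two subalgebras of finite unions of intersections of their parts, and
    the norm of A is a supremum over the members of R_mu below A. Hence
    A |-> Phi(A) is an entropy-preserving bijection between the finite
    subalgebras of R_mu and those of R_nu, as Phi intertwines the preimage maps
    of T and S. *)
Require Import Defs.
From mathcomp Require Import all_boot all_order all_algebra finmap.
From mathcomp Require Import all_classical all_reals all_analysis.
From mathcomp Require Import ring.

Set Implicit Arguments.
Unset Strict Implicit.
Unset Printing Implicit Defensive.

Import Order.TTheory GRing.Theory Num.Theory.
Import numFieldNormedType.Exports.

Local Open Scope classical_set_scope.
Local Open Scope ring_scope.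

(** * Algebras of sets and finite unions *)

Record set_algebra (X : Type) (E : set (set X)) : Prop := SetAlgebra {
  set_algT : E setT;
  set_algC : forall A, E A -> E (~` A);
  set_algU : forall A B, E A -> E B -> E (A `|` B) }.

Lemma set_alg0 (X : Type) (E : set (set X)) : set_algebra E -> E set0.
Proof. by move=> hE; rewrite -setCT; apply: set_algC (set_algT hE). Qed.

Lemma set_algI (X : Type) (E : set (set X)) A B :
  set_algebra E -> E A -> E B -> E (A `&` B).
Proof.
move=> hE EA EB; rewrite -(setCK (A `&` B)) setCI.
by apply: set_algC => //; apply: set_algU => //; apply: set_algC.
Qed.

Lemma finite_subalgebraP (X : Type) (E A : set (set X)) :
  finite_subalgebra E A <-> [/\ finite_set A, A `<=` E & set_algebra A].
Proof.
split=> [[fA AE AT CA AU]|[fA AE [AT CA AU]]]; first by split.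
by split.
Qed.

(** [P] sees the family as well as its union, so that the union can be compared with one over a
    transported family. Induction on a list enumerating [D]. *)
Lemma finite_bigcup_ind (X : Type) (P : set (set X) -> set X -> Prop)
    (D : set (set X)) :
  finite_set D -> P set0 set0 ->
  (forall C D', D C -> D' `<=` D -> P D' (\bigcup_(A in D') A) ->
     P (C |` D') (C `|` \bigcup_(A in D') A)) ->
  P D (\bigcup_(A in D) A).
Proof.
move=> fD P0 PU.
have [s sD] := (finite_seqP D).1 fD.
have: forall t : seq (set X), {subset t <= s} ->
    P [set` t] (\bigcup_(A in [set` t]) A).
  elim=> [|C t IH] ts; first by rewrite set_nil bigcup_set0.
  have -> : [set` C :: t] = C |` [set` t].
    apply/seteqP; split=> A /=; rewrite in_cons; first by move=> /predU1P.
    by move=> /predU1P.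
  rewrite bigcup_setU1; apply: PU.
  - by rewrite sD /= ts // mem_head.
  - by move=> A /= At; rewrite sD /= ts // in_cons At orbT.
  - by apply: IH => A At; apply: ts; rewrite in_cons At orbT.
by rewrite sD; apply.
Qed.

(** Gives the finiteness of a join, whose members are indexed by the subfamilies of a finite
    family. *)
Lemma finite_powerset (X : Type) (J : set (set X)) :
  finite_set J -> finite_set [set D | D `<=` J].
Proof.
move=> fJ; apply: (@sub_finite_set _ _
  ((fun D : {fset set X} => [set` D]) @` [set` fpowerset (fset_set J)])).
  move=> D DJ; have fD := sub_finite_set DJ fJ; exists (fset_set D).
    by rewrite /= fpowersetE -fset_set_sub.
  exact: fset_setK.
by apply: finite_image; exact: finite_fset.
Qed.

Lemma subset_image_ex (T U : Type) (f : T -> U) (J : set T) (D : set U) :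
  D `<=` f @` J -> exists2 D', D' `<=` J & f @` D' = D.
Proof.
move=> DJ; exists (J `&` f @^-1` D); first exact: subIsetl.
apply/seteqP; split=> [_ [x [_ Dx] <-]//|y Dy].
by have [x Jx xy] := DJ y Dy; exists x => //; split=> //=; rewrite xy.
Qed.

Lemma set_alg_bigcup (X : Type) (E D : set (set X)) :
  set_algebra E -> finite_set D -> D `<=` E -> E (\bigcup_(A in D) A).
Proof.
move=> hE fD DE.
apply: (@finite_bigcup_ind _ (fun _ => E)) => //; first exact: set_alg0.
by move=> C D' DC _ ?; apply: set_algU => //; apply: DE.
Qed.

Lemma set_alg_bigcap (X : Type) (E D : set (set X)) :
  set_algebra E -> finite_set D -> D `<=` E -> E (\bigcap_(A in D) A).
Proof.
move=> hE fD DE; rewrite -[\bigcap_(A in D) A]setCK setC_bigcap.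
rewrite -(bigcup_image D setC id); apply: set_algC => //; apply: set_alg_bigcup => //.
  exact: finite_image.
by move=> _ [A DA <-]; apply: set_algC => //; exact: DE.
Qed.

(** * Atoms of a finite algebra *)

(** The atom of [x] is the intersection of the finitely many members containing [x]: if [C] misses
    [x], its complement is one of these members, so [C] misses their intersection. *)
Lemma atom_in_alg (X : Type) (A : set (set X)) x :
  set_algebra A -> finite_set A -> A (atom A x).
Proof.
move=> hA fA.
have -> : atom A x = \bigcap_(C in [set C | A C /\ C x]) C.
  apply/seteqP; split=> y; first by move=> xy C [CA Cx]; apply/(xy C CA).
  move=> H C CA; split=> [Cx|Cy]; first exact: H.
  by apply: contrapT => nCx; apply: (H (~` C)) => //; split => //; apply: set_algC.
by apply: set_alg_bigcap => //; [apply: (sub_finite_set _ fA) => C []|move=> C []].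
Qed.

(* The right-hand side refers only to the inclusion order of A, so isomorphisms
   of algebras preserve it. *)
Lemma alpha_minimal (X : Type) (A : set (set X)) :
  set_algebra A -> finite_set A ->
  alpha A = [set P | [/\ A P, P <> set0 &
    forall C, A C -> C `<=` P -> C <> set0 -> C = P]].
Proof.
move=> hA fA; rewrite alphaE; apply/seteqP; split=> [_ [x _ <-]|P [AP P0 Pmin]].
  split; first exact: atom_in_alg.
    by apply/eqP/set0P; exists x.
  move=> C CA Cx /eqP/set0P[y Cy]; apply/seteqP; split => // z xz.
  by apply/(xz _ CA); apply/(Cx y Cy C CA).
have /eqP/set0P[x Px] := P0; exists x => //; apply: Pmin.
- exact: atom_in_alg.
- by move=> y xy; apply/(xy _ AP).
- by apply/eqP/set0P; exists x.
Qed.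

Lemma alpha_sub (X : Type) (A : set (set X)) :
  set_algebra A -> finite_set A -> alpha A `<=` A.
Proof. by move=> hA fA; rewrite alpha_minimal // => P []. Qed.

(** * Isomorphisms of algebras of sets *)

(** The Boolean part of a measure algebra isomorphism. [Phi] acts on sets and need not come from a
    map of points, so only properties expressed by the set operations or by inclusion can be
    transported. *)
Record set_algebra_iso (X Y : Type) (E : set (set X)) (F : set (set Y))
    (Phi : set X -> set Y) : Prop := SetAlgebraIso {
  sai_dom : set_algebra E;
  sai_sub : forall A, E A -> F (Phi A);
  sai_inj : forall A B, E A -> E B -> Phi A = Phi B -> A = B;
  sai_surj : forall B, F B -> exists2 A, E A & Phi A = B;
  sai_setC : forall A, E A -> Phi (~` A) = ~` Phi A;
  sai_setU : forall A B, E A -> E B -> Phi (A `|` B) = Phi A `|` Phi B }.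

Lemma saiT (X Y : Type) (E : set (set X)) (F : set (set Y)) Phi :
  set_algebra_iso E F Phi -> Phi setT = setT.
Proof.
move=> h; have hE := sai_dom h.
by rewrite -(setUv setT) (sai_setU h) ?(sai_setC h) ?setUv//;
  [exact: set_algT hE|exact: set_algT hE|exact: (set_algC hE (set_algT hE))].
Qed.

Lemma sai0 (X Y : Type) (E : set (set X)) (F : set (set Y)) Phi :
  set_algebra_iso E F Phi -> Phi set0 = set0.
Proof.
move=> h; rewrite -setCT (sai_setC h) ?(saiT h) ?setCT//.
exact: set_algT (sai_dom h).
Qed.

Lemma saiI (X Y : Type) (E : set (set X)) (F : set (set Y)) Phi A B :
  set_algebra_iso E F Phi -> E A -> E B -> Phi (A `&` B) = Phi A `&` Phi B.
Proof.
move=> h EA EB; have hE := sai_dom h.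
have EC C : E C -> E (~` C) by apply: set_algC.
rewrite -[A `&` B]setCK setCI (sai_setC h) ?(sai_setU h) ?(sai_setC h)//.
- by rewrite setCU !setCK.
- exact: EC.
- exact: EC.
- by apply: set_algU => //; apply: EC.
Qed.

(** Inclusion is the equation A ∩ B = A, which [Phi] preserves and, being injective on [E],
    reflects. *)
Lemma sai_subset (X Y : Type) (E : set (set X)) (F : set (set Y)) Phi A B :
  set_algebra_iso E F Phi -> E A -> E B -> (Phi A `<=` Phi B <-> A `<=` B).
Proof.
move=> h EA EB; rewrite -!setIidPl -(saiI h) //; split=> [|->//].
by apply: (sai_inj h) => //; apply: set_algI => //; apply: sai_dom h.
Qed.

Lemma sai_bigcup (X Y : Type) (E : set (set X)) (F : set (set Y)) Phi D :
  set_algebra_iso E F Phi -> finite_set D -> D `<=` E ->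
  Phi (\bigcup_(A in D) A) = \bigcup_(A in Phi @` D) A.
Proof.
move=> h fD DE; rewrite bigcup_image.
apply: (@finite_bigcup_ind _
  (fun D U => Phi U = \bigcup_(A in D) Phi A)) => //.
  by rewrite bigcup_set0 (sai0 h).
move=> C D' DC D'D IH; rewrite bigcup_setU1 -IH (sai_setU h) //; first exact: DE.
apply: set_alg_bigcup; [exact: sai_dom h|exact: sub_finite_set D'D fD|].
exact: subset_trans D'D DE.
Qed.

Lemma sai_image_alg (X Y : Type) (E A : set (set X)) (F : set (set Y)) Phi :
  set_algebra_iso E F Phi -> finite_subalgebra E A ->
  finite_subalgebra F (Phi @` A).
Proof.
move=> h /finite_subalgebraP[fA AE hA]; apply/finite_subalgebraP; split.
- exact: finite_image.
- by move=> _ [C CA <-]; apply/(sai_sub h)/AE.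
split; first by exists setT; [exact: set_algT|exact: saiT h].
- move=> _ [C CA <-]; exists (~` C); first exact: set_algC.
  by rewrite (sai_setC h)//; apply: AE.
- move=> _ _ [C CA <-] [D AD <-]; exists (C `|` D); first exact: set_algU.
  by rewrite (sai_setU h)//; apply: AE.
Qed.

(** Makes the supremum over the finite subalgebras of [F] a supremum over images of finite
    subalgebras of [E]. *)
Lemma sai_preimage_alg (X Y : Type) (E : set (set X)) (F B : set (set Y)) Phi :
  set_algebra_iso E F Phi -> finite_subalgebra F B ->
  exists2 A, finite_subalgebra E A & Phi @` A = B.
Proof.
move=> h /finite_subalgebraP[fB BF hB]; have hE := sai_dom h.
have imB : Phi @` (E `&` Phi @^-1` B) = B.
  apply/seteqP; split=> [_ [A [_ BA] <-]//|C BC].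
  by have [A EA CA] := sai_surj h (BF _ BC); exists A => //; split => //; rewrite /= CA.
exists (E `&` Phi @^-1` B) => //; apply/finite_subalgebraP; split.
(* By injectivity the preimage is equinumerous with the finite set [B]. *)
- suff cAB : (Phi @` (E `&` Phi @^-1` B) #= E `&` Phi @^-1` B)%card.
    by rewrite -(eq_finite_set cAB) imB.
  by apply: inj_card_eq => C D /set_mem[EC _] /set_mem[ED _]; exact: (sai_inj h).
- exact: subIsetl.
split.
- by split; [exact: set_algT|rewrite /= (saiT h); exact: set_algT].
- by move=> C [EC BC]; split; [exact: set_algC|rewrite /= (sai_setC h)//; exact: set_algC].
- move=> C D [EC BC] [ED BD]; split; first exact: set_algU.
  by rewrite /= (sai_setU h)//; exact: set_algU.
Qed.

(** [alpha_minimal] describes the parts by inclusion and nonemptiness alone, and [Phi] preserves and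
    reflects both. *)
Lemma sai_alpha (X Y : Type) (E A : set (set X)) (F : set (set Y)) Phi :
  set_algebra_iso E F Phi -> finite_subalgebra E A ->
  alpha (Phi @` A) = Phi @` alpha A.
Proof.
move=> h fsA.
have /finite_subalgebraP[fB BF hB] := sai_image_alg h fsA.
have /finite_subalgebraP[fA AE hA] := fsA.
have Phi_eq0 C : A C -> Phi C = set0 <-> C = set0.
  move=> CA; split=> [|->]; last exact: sai0 h.
  rewrite -(sai0 h); apply: (sai_inj h); first exact: AE.
  exact: set_alg0 (sai_dom h).
rewrite !alpha_minimal //; apply/seteqP; split.
  move=> _ [[P AP <-] P0 Pmin]; exists P => //; split => //.
    by move/(Phi_eq0 P AP).
  move=> C CA CP C0; apply: (sai_inj h); [exact: AE|exact: AE|].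
  apply: Pmin; first by exists C.
    by apply/(sai_subset h) => //; apply: AE.
  by move/(Phi_eq0 C CA).
move=> _ [P [AP P0 Pmin] <-]; split; first by exists P.
  by move/(Phi_eq0 P AP).
move=> _ [C CA <-] CP C0; congr Phi; apply: Pmin => //.
  by apply/(sai_subset h _ _).1 => //; apply: AE.
by move/(Phi_eq0 C CA).
Qed.

(** * Joins of finite subalgebras *)

Lemma finite_partition_join (X : Type) (E A B : set (set X)) :
  finite_subalgebra E A -> finite_subalgebra E B ->
  finite_set (partition_join (alpha A) (alpha B)).
Proof.
move=> /finite_subalgebraP[fA _ hA] /finite_subalgebraP[fB _ hB].
by apply: finite_image2;
  [exact: sub_finite_set (alpha_sub hA fA) fA
  |exact: sub_finite_set (alpha_sub hB fB) fB].
Qed.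

Lemma partition_join_sub (X : Type) (E A B : set (set X)) :
  set_algebra E -> finite_subalgebra E A -> finite_subalgebra E B ->
  partition_join (alpha A) (alpha B) `<=` E.
Proof.
move=> hE /finite_subalgebraP[fA AE hA] /finite_subalgebraP[fB BE hB].
by move=> _ [P /(alpha_sub hA fA) AP [Q /(alpha_sub hB fB) BQ <-]];
  apply: set_algI => //; [exact: AE|exact: BE].
Qed.

(** The members are the unions of subfamilies of a finite cover by pairwise disjoint sets; the
    complement of such a union is the union of the remaining sets. *)
Lemma algebra_join_subalgebra (X : Type) (E A B : set (set X)) :
  set_algebra E -> finite_subalgebra E A -> finite_subalgebra E B ->
  finite_subalgebra E (algebra_join A B).
Proof.
move=> hE hA hB; have fJ := finite_partition_join hA hB.
have JE := partition_join_sub hE hA hB.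
apply/finite_subalgebraP; split.
- apply: (@sub_finite_set _ _
    ((fun D => \bigcup_(P in D) P) @`
       [set D | D `<=` partition_join (alpha A) (alpha B)])).
    by move=> _ [D DJ ->]; exists D.
  by apply: finite_image; exact: finite_powerset.
- move=> _ [D DJ ->]; apply: set_alg_bigcup => //; first exact: sub_finite_set fJ.
  exact: subset_trans JE.
have JT x : exists2 P, partition_join (alpha A) (alpha B) P & P x.
  exists (atom A x `&` atom B x); last by [].
  by rewrite !alphaE; exists (atom A x); [exists x|exists (atom B x) => //; exists x].
(* Disjointness is stated through a common point, since [partition_join] may contain the empty
   set. *)
have Jtriv P Q x : partition_join (alpha A) (alpha B) P ->
    partition_join (alpha A) (alpha B) Q -> P x -> Q x -> P = Q.
  have aE Z a z : atom Z a z -> atom Z a = atom Z z :> set X.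
    move=> az; apply/seteqP; split=> y h C ZC.
      by rewrite -(az C ZC); exact: h.
    by rewrite (az C ZC); exact: h.
  rewrite !alphaE.
  move=> [_ [a _ <-] [_ [b _ <-] <-]] [_ [c _ <-] [_ [d _ <-] <-]].
  by move=> [/aE -> /aE ->] [/aE -> /aE ->].
split.
- exists (partition_join (alpha A) (alpha B)) => //.
  by apply/seteqP; split=> // x _; have [P JP Px] := JT x; exists P.
- move=> _ [D DJ ->]; exists (partition_join (alpha A) (alpha B) `\` D).
    exact: subDsetl.
  apply/seteqP; split=> x.
    by move=> nDx; have [P JP Px] := JT x; exists P => //; split=> // DP; apply: nDx; exists P.
  move=> [P [JP nDP] Px] [Q DQ Qx]; apply: nDP.
  by rewrite (Jtriv _ _ _ JP (DJ _ DQ) Px Qx).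
- move=> _ _ [D DJ ->] [D' D'J ->]; exists (D `|` D'); last by rewrite bigcup_setU.
  by rewrite subUset.
Qed.

Lemma sai_algebra_join (X Y : Type) (E A B : set (set X)) (F : set (set Y)) Phi :
  set_algebra_iso E F Phi -> finite_subalgebra E A -> finite_subalgebra E B ->
  algebra_join (Phi @` A) (Phi @` B) = Phi @` algebra_join A B.
Proof.
move=> h fsA fsB; have hE := sai_dom h.
have fJ := finite_partition_join fsA fsB.
have JE := partition_join_sub hE fsA fsB.
have PhiJ : partition_join (alpha (Phi @` A)) (alpha (Phi @` B)) =
    Phi @` partition_join (alpha A) (alpha B).
  rewrite (sai_alpha h fsA) (sai_alpha h fsB).
  have /finite_subalgebraP[fA AE hA] := fsA.
  have /finite_subalgebraP[fB BE hB] := fsB.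
  have EPQ P Q : alpha A P -> alpha B Q -> Phi (P `&` Q) = Phi P `&` Phi Q.
    move=> /(alpha_sub hA fA)/AE EP /(alpha_sub hB fB)/BE EQ.
    exact: (saiI h EP EQ).
  apply/seteqP; split.
    move=> _ [_ [P aP <-] [_ [Q bQ <-] <-]]; exists (P `&` Q); last exact: EPQ.
    by exists P => //; exists Q.
  move=> _ [_ [P aP [Q bQ <-]] <-]; exists (Phi P); first by exists P.
  by exists (Phi Q); [exists Q|rewrite EPQ].
rewrite /algebra_join PhiJ; apply/seteqP; split.
  (* A subfamily of the image of the joined partition is the image of a subfamily, and [Phi]
     commutes with its finite union. *)
  move=> _ [_ /subset_image_ex[D DJ <-] ->].
  exists (\bigcup_(P in D) P); first by exists D.
  by apply: (sai_bigcup h); [exact: sub_finite_set fJ|exact: subset_trans JE].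
move=> _ [_ [D DJ ->] <-]; exists (Phi @` D); first exact: image_subset.
by apply: (sai_bigcup h); [exact: sub_finite_set fJ|exact: subset_trans JE].
Qed.

(** * Iterated preimages and iterated joins *)

(** The outermost [T] of the iterate is the first to be pulled back, so inductions on [i] must let
    [C] vary. *)
Lemma iter_preimageS (X : Type) (T : X -> X) i (C : set X) :
  iter i.+1 T @^-1` C = iter i T @^-1` (T @^-1` C).
Proof. by []. Qed.

Lemma alg_iter_preimage (X : Type) (E : set (set X)) (T : X -> X) i C :
  (forall C, E C -> E (T @^-1` C)) -> E C -> E (iter i T @^-1` C).
Proof. by move=> ET; elim: i C => // i IH C EC; apply: (IH (T @^-1` C)); exact: ET. Qed.

Lemma preimage_subalgebra (X : Type) (E A : set (set X)) (T : X -> X) i :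
  (forall C, E C -> E (T @^-1` C)) -> finite_subalgebra E A ->
  finite_subalgebra E (preimage_algebra T i A).
Proof.
move=> ET /finite_subalgebraP[fA AE hA]; apply/finite_subalgebraP; split.
- exact: finite_image.
- by move=> _ [C CA <-]; apply: alg_iter_preimage => //; apply: AE.
split; first by exists setT; [exact: set_algT|rewrite preimage_setT].
- by move=> _ [C CA <-]; exists (~` C); [exact: set_algC|rewrite preimage_setC].
- move=> _ _ [C CA <-] [D AD <-]; exists (C `|` D); first exact: set_algU.
  by rewrite preimage_setU.
Qed.

Lemma trivial_subalgebra (X : Type) (E : set (set X)) :
  set_algebra E -> finite_subalgebra E [set set0; setT].
Proof.
move=> hE; apply/finite_subalgebraP; split.
- exact: finite_set2.
- by move=> _ [->|->]; [exact: set_alg0|exact: set_algT].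
split; first by right.
- by move=> _ [->|->]; [rewrite setC0; right|rewrite setCT; left].
- move=> _ _ [->|->] [->|->]; rewrite ?setUT ?setTU ?set0U;
  by [left|right].
Qed.

Lemma iterated_join_subalgebra (X : Type) (E A : set (set X)) (T : X -> X) n :
  set_algebra E -> (forall C, E C -> E (T @^-1` C)) -> finite_subalgebra E A ->
  finite_subalgebra E (iterated_join T A n).
Proof.
move=> hE ET fsA; rewrite /iterated_join; apply: big_rec.
  exact: trivial_subalgebra.
move=> i B _ fsB; apply: algebra_join_subalgebra => //.
exact: preimage_subalgebra.
Qed.

Lemma sai_iterated_join (X Y : Type) (E A : set (set X)) (F : set (set Y)) Phi
    (T : X -> X) (S : Y -> Y) n :
  set_algebra_iso E F Phi -> (forall C, E C -> E (T @^-1` C)) ->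
  (forall C, E C -> Phi (T @^-1` C) = S @^-1` Phi C) ->
  finite_subalgebra E A ->
  iterated_join S (Phi @` A) n = Phi @` iterated_join T A n.
Proof.
move=> h ET PhiT fsA; have hE := sai_dom h.
have PhiTi i C : E C -> Phi (iter i T @^-1` C) = iter i S @^-1` Phi C.
  elim: i C => // i IH C EC.
  by rewrite !iter_preimageS IH ?PhiT //; apply: ET.
have PhiP i : preimage_algebra S i (Phi @` A) = Phi @` preimage_algebra T i A.
  have /finite_subalgebraP[_ AE _] := fsA.
  rewrite /preimage_algebra !image_comp; apply: eq_imagel => C CA.
  by rewrite /= PhiTi //; apply: AE.
(* The subalgebra property is carried through the recursion because [sai_algebra_join] requires it
   of both factors. *)
suff : finite_subalgebra E (iterated_join T A n) /\
    iterated_join S (Phi @` A) n = Phi @` iterated_join T A n by case.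
rewrite /iterated_join; apply: (big_rec2 (fun B' B =>
  finite_subalgebra E B /\ B' = Phi @` B)).
  split; first exact: trivial_subalgebra.
  by rewrite image_setU !image_set1 (saiT h) (sai0 h).
move=> i B' B _ [fsB ->].
have fsT := preimage_subalgebra i ET fsA.
split; first exact: algebra_join_subalgebra.
by rewrite PhiP (sai_algebra_join h).
Qed.

(** * The absolute value and step functions *)

Section AbsoluteValue.
Context (R : realType) (K : fieldType) (v : K -> R).
Hypothesis hv : complete_nonarch_absval v.

Lemma absval0 : v 0 = 0.
Proof. exact/(absval_eq0 hv). Qed.

Lemma absval1 : v 1 = 1.
Proof.
have v1 : v 1 != 0.
  by apply/eqP => /(absval_eq0 hv)/eqP; rewrite oner_eq0.
by apply: (mulfI v1); rewrite -(absvalM hv) !mulr1.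
Qed.

Lemma absvalN x : v (- x) = v x.
Proof.
have : v (-1) ^+ 2 = 1 by rewrite expr2 -(absvalM hv) mulrNN mulr1 absval1.
move/eqP; rewrite sqrf_eq1 => /orP[] /eqP v1.
  by rewrite -mulN1r (absvalM hv) v1 mul1r.
by have := absval_ge0 hv (-1); rewrite v1 oppr_ge0 ler10.
Qed.

Lemma absval_indic (X : Type) (A : set X) x : v (\1_A x) <= 1.
Proof. by rewrite indicE; case: (_ \in _); rewrite ?absval1 ?absval0. Qed.

Lemma step_fun_bounded (X : Type) (s : seq (K * set X)) :
  exists2 M : R, 0 < M & forall x, v (step_fun s x) <= M.
Proof.
elim: s => [|p s [M M0 IH]]; rewrite /step_fun.
  (* The bound is 1 rather than 0 for the zero function: [ext_ringI] divides by it. *)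
  by exists 1 => // x; rewrite big_nil absval0.
exists (Num.max (v p.1) M); first by rewrite lt_max M0 orbT.
move=> x; rewrite big_cons; apply: (le_trans (absval_ultra hv _ _)).
rewrite ge_max !le_max IH orbT andbT (absvalM hv).
by rewrite ler_piMr ?(absval_ge0 hv)// absval_indic.
Qed.

End AbsoluteValue.

(** The pointwise product is again a step function, since indicators multiply by intersecting their
    sets. *)
Lemma step_funM (K : fieldType) (X : Type) (s t : seq (K * set X)) x :
  step_fun [seq (p.1 * q.1, p.2 `&` q.2) | p <- s, q <- t] x =
  step_fun s x * step_fun t x.
Proof.
rewrite /step_fun big_allpairs_dep mulr_suml; apply: eq_bigr => p _.
rewrite mulr_sumr; apply: eq_bigr => q _ /=.
by rewrite indicI /= mulrACA.
Qed.

Lemma is_stepM (K : fieldType) (X : Type) (Rg : set (set X))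
    (s t : seq (K * set X)) :
  covering_ring Rg -> is_step Rg s -> is_step Rg t ->
  is_step Rg [seq (p.1 * q.1, p.2 `&` q.2) | p <- s, q <- t].
Proof.
move=> hRg hs ht _ /allpairsP[[p q] /= [ps qt ->]] /=.
by apply: (ring_setI hRg); [exact: hs|exact: ht].
Qed.

(** * The sets with integrable indicator form an algebra *)

Section ExtendedRing.
Context (R : realType) (K : fieldType) (v : K -> R).
Hypothesis hv : complete_nonarch_absval v.
Context (X : Type) (Rg : set (set X)) (mu : set X -> K).
Hypothesis hmu : probability_space v Rg mu.

Lemma prob_set0 : Rg set0.
Proof.
by rewrite -(setDv setT); apply: (ring_setD (prob_ring hmu)); apply: prob_algebra hmu.
Qed.

(** On an empty space the whole set is empty, and additivity would give 1 = 1 + 1. A point is needed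
    because the supremum in [fnorm] over an empty range is minus infinity. *)
Lemma prob_nonempty : exists x : X, True.
Proof.
apply: contrapT => X0.
have T0 : [set: X] = set0.
  by apply/seteqP; split => // x _; apply: X0; exists x.
have := measure_additive (prob_measure hmu) prob_set0 prob_set0 (setI0 set0).
rewrite setU0 -T0 (prob_total hmu) => /eqP.
by rewrite -subr_eq0 opprD addrA subrr sub0r oppr_eq0 oner_eq0.
Qed.

Lemma mnorm_ge0 A : Rg A -> 0 <= mnorm v Rg mu A.
Proof.
move=> RA; apply: (le_trans (absval_ge0 hv (mu set0))).
apply: (ub_le_sup (measure_bounded (prob_measure hmu) RA)).
by exists set0 => //; split; [exact: prob_set0|exact: sub0set].
Qed.

Lemma Nmu_ge0 x : 0 <= Nmu v Rg mu x.
Proof.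
apply: lb_le_inf; last by move=> _ [U [RU _] <-]; exact: mnorm_ge0.
by exists (mnorm v Rg mu setT), setT => //; split=> //; exact: prob_algebra hmu.
Qed.

(** Replaces convergence in the extended reals by estimates uniform in the point, with which the
    closure properties of the extended ring are proved. Conversely, approximations within 1/(n+1)
    give the sequence. *)
Lemma is_integrableP f :
  is_integrable v Rg mu f <->
  forall e : R, 0 < e -> exists2 s, is_step Rg s &
    forall x, v (step_fun s x - f x) * Nmu v Rg mu x <= e.
Proof.
split=> [[s [hs cs]] e e0|H].
  have [] := cs [set y | (y < e%:E)%E].
    by apply: open_nbhs_nbhs; split; [exact: open_ereal_lt_ereal|rewrite /= lte_fin].
  move=> N _ /(_ N (leqnn N)) /= hN; exists (s N) => // x.
  rewrite -lee_fin; apply: le_trans (ltW hN).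
  by apply: ereal_sup_ubound; exists x.
have /choice[s hs] n : exists s, is_step Rg s /\
    forall x, v (step_fun s x - f x) * Nmu v Rg mu x <= n.+1%:R^-1.
  by have [|s] := H n.+1%:R^-1; [rewrite invr_gt0 ltr0n|exists s].
exists s; split; first by move=> n; have [] := hs n.
have [x0 _] := prob_nonempty.
apply: (@squeeze_cvge _ _ _ _ (cst 0%E) _ (EFin \o @harmonic R)).
(* The value at [x0] is nonnegative, so the supremum is at least 0. *)
- apply: nearW => n; apply/andP; split.
    apply: le_ereal_sup_tmp; eexists; first by exists x0.
    by rewrite lee_fin mulr_ge0 ?Nmu_ge0// (absval_ge0 hv).
  by apply: ge_ereal_sup => _ [x _ <-]; rewrite lee_fin; case: (hs n).
- exact: cvg_cst.
- exact: cvge_harmonic.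
Qed.

Lemma ext_ring_sub : Rg `<=` ext_ring v Rg mu.
Proof.
move=> A RA; apply/is_integrableP => e e0; exists [:: (1, A)].
  by move=> p; rewrite inE => /eqP ->.
move=> x; rewrite /step_fun big_seq1 mul1r subrr (absval0 hv) mul0r.
exact: ltW.
Qed.

Lemma ext_ringC A : ext_ring v Rg mu A -> ext_ring v Rg mu (~` A).
Proof.
move=> /is_integrableP hA; apply/is_integrableP => e /hA[s hs sA].
(* The step function 1 - s, whose error for the complement is the negative of the error of s for
   [A]. *)
exists ((1, setT) :: [seq (- p.1, p.2) | p <- s]).
  move=> p; rewrite inE => /predU1P[->|/mapP[q qs ->]]; first exact: prob_algebra hmu.
  exact: (hs _ qs).
move=> x; rewrite /step_fun big_cons big_map /=.
under eq_bigr do rewrite mulNr.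
rewrite sumrN -/(step_fun s x).
suff -> : 1 * \1_setT x - step_fun s x - \1_(~` A) x =
    - (step_fun s x - \1_A x) by rewrite (absvalN hv).
rewrite indicT indicC indicE mul1r.
case: (x \in A); rewrite /=; ring.
Qed.

(* With g bounded by M, the product f g approximates 1_A 1_B as soon as f
   approximates 1_A within e / M, because
   f g - 1_A 1_B = (f - 1_A) g + 1_A (g - 1_B). *)
Lemma ext_ringI A B :
  ext_ring v Rg mu A -> ext_ring v Rg mu B -> ext_ring v Rg mu (A `&` B).
Proof.
move=> /is_integrableP hA /is_integrableP hB; apply/is_integrableP => e e0.
have [t ht tB] := hB e e0.
have [M M0 tM] := step_fun_bounded hv t.
have [|s hs sA] := hA (e / M); first exact: divr_gt0.
exists [seq (p.1 * q.1, p.2 `&` q.2) | p <- s, q <- t].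
  exact: is_stepM (prob_ring hmu) hs ht.
move=> x; rewrite step_funM indicI /=.
set f := step_fun s x; set g := step_fun t x.
have -> : f * g - \1_A x * \1_B x =
    (f - \1_A x) * g + \1_A x * (g - \1_B x) by ring.
apply: (@le_trans _ _ (Num.max (v ((f - \1_A x) * g)) (v (\1_A x * (g - \1_B x)))
   * Nmu v Rg mu x)).
  by rewrite ler_wpM2r ?Nmu_ge0// (absval_ultra hv).
have N0 := Nmu_ge0 x.
rewrite maxr_pMl // ge_max !(absvalM hv); apply/andP; split.
  rewrite mulrAC -[leRHS](divfK (lt0r_neq0 M0)).
  by apply: ler_pM => //; rewrite ?mulr_ge0 ?(absval_ge0 hv)//; [exact: sA|exact: tM].
rewrite -mulrA -[leRHS]mul1r.
apply: ler_pM; rewrite ?mulr_ge0 ?(absval_ge0 hv)//; first exact: absval_indic.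
exact: tB.
Qed.

Lemma ext_ring_algebra : set_algebra (ext_ring v Rg mu).
Proof.
split.
- exact/ext_ring_sub/(prob_algebra hmu).
- exact: ext_ringC.
- move=> A B hA hB; rewrite -(setCK (A `|` B)) setCU.
  by apply: ext_ringC; apply: ext_ringI; apply: ext_ringC.
Qed.

End ExtendedRing.

(** * Invariance of the entropy under measure algebra isomorphisms *)

Section Conjugacy.
Context (R : realType) (K : fieldType) (v : K -> R).
Context (X Y : Type) (RX : set (set X)) (mu : set X -> K).
Context (RY : set (set Y)) (nu : set Y -> K) (Phi : set X -> set Y).
Hypothesis hPhi : measure_algebra_iso v RX mu RY nu Phi.
Hypothesis hmu : set_algebra (ext_ring v RX mu).

Local Notation Rmu := (ext_ring v RX mu).
Local Notation Rnu := (ext_ring v RY nu).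

Lemma measure_algebra_iso_sai : set_algebra_iso Rmu Rnu Phi.
Proof.
have [[fPhi iPhi sPhi] PhiC PhiU _] := hPhi; split=> //.
by move=> A B EA EB; apply: iPhi; exact: mem_set.
Qed.

(** [Phi] matches the members of the extended ring below [A] with those below [Phi A] and keeps
    their measures, so both suprema are over the same set of values. *)
Lemma set_norm_iso A : Rmu A -> set_norm v RY nu (Phi A) = set_norm v RX mu A.
Proof.
have h := measure_algebra_iso_sai => EA; congr sup; apply/seteqP; split.
  move=> _ [_ [/(sai_surj h)[B EB <-] BA] <-]; exists B; last by rewrite (iso_measure hPhi).
  by split=> //; apply/(sai_subset h).
move=> _ [B [EB BA] <-]; exists (Phi B); last by rewrite (iso_measure hPhi).
by split; [exact: sai_sub h _ EB|apply/(sai_subset h)].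
Qed.

Lemma nonnull_iso A : finite_subalgebra Rmu A ->
  nonnull v RY nu (alpha (Phi @` A)) = Phi @` nonnull v RX mu (alpha A).
Proof.
have h := measure_algebra_iso_sai => fsA; rewrite (sai_alpha h fsA).
have [fA AE hA] := (finite_subalgebraP _ _).1 fsA.
have aE : alpha A `<=` Rmu by exact: subset_trans (alpha_sub hA fA) AE.
apply/seteqP; split.
  move=> _ [[P aP <-]]; rewrite set_norm_iso; last exact: aE.
  by move=> P0; exists P.
move=> _ [P [aP P0] <-]; split; first by exists P.
by rewrite set_norm_iso //; exact: aE.
Qed.

Lemma Hentropy_iso A : finite_subalgebra Rmu A ->
  Hentropy v RY nu (Phi @` A) = Hentropy v RX mu A.
Proof.
have h := measure_algebra_iso_sai => fsA; rewrite /Hentropy nonnull_iso //.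
have [fA AE hA] := (finite_subalgebraP _ _).1 fsA.
have NE : nonnull v RX mu (alpha A) `<=` Rmu.
  by move=> P [/(alpha_sub hA fA)/AE].
have fN : finite_set (nonnull v RX mu (alpha A)).
  by apply: (sub_finite_set _ fA) => P [/(alpha_sub hA fA)].
congr (inf _ * log2 _%:R).
  rewrite image_comp; apply: eq_imagel => P NP /=.
  by rewrite set_norm_iso //; exact: NE.
(* The number of nonnull parts is kept because [Phi] is injective on the extended ring. *)
rewrite fset_set_image // card_in_imfset // => P Q.
rewrite !in_fset_set // => /set_mem/NE EP /set_mem/NE EQ.
exact: (sai_inj h).
Qed.

Lemma entropy_iso (T : X -> X) (S : Y -> Y) :
  (forall C, Rmu C -> Rmu (T @^-1` C)) ->
  (forall C, Rmu C -> Phi (T @^-1` C) = S @^-1` Phi C) ->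
  entropy v RX mu T = entropy v RY nu S.
Proof.
have h := measure_algebra_iso_sai => ET PhiT.
have eqE A : finite_subalgebra Rmu A ->
    entropy_of v RY nu S (Phi @` A) = entropy_of v RX mu T A.
  (* The two sequences agree term by term, hence so do the values of [lim], whether or not they
     converge. *)
  move=> fsA; congr (lim (_ @ \oo)); apply/funext => n.
  rewrite (sai_iterated_join n h ET PhiT fsA) Hentropy_iso //.
  exact: iterated_join_subalgebra.
congr ereal_sup; apply/seteqP; split.
  move=> _ [A fsA <-]; exists (Phi @` A); first exact: sai_image_alg h fsA.
  by rewrite eqE.
move=> _ [B fsB <-]; have [A fsA AB] := sai_preimage_alg h fsB.
by exists A => //; rewrite -AB eqE.
Qed.

End Conjugacy.

Theorem proposition4p11 (R : realType) (K : fieldType) (v : K -> R)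
  (hK : complete_nonarch_absval v)
  (X Y : Type) (RX : set (set X)) (mu : set X -> K)
  (RY : set (set Y)) (nu : set Y -> K)
  (hX : probability_space v RX mu) (hY : probability_space v RY nu)
  (T : X -> X) (S : Y -> Y)
  (hT : measure_preserving v RX mu T) (hS : measure_preserving v RY nu S)
  (hTS : conjugate v RX mu T RY nu S) :
  entropy v RX mu T = entropy v RY nu S.
Proof.
have [Phi [Psi [hPhi PhiK PsiK PsiS]]] := hTS.
have hE := ext_ring_algebra hK hX.
have h := measure_algebra_iso_sai hPhi hE.
apply: (entropy_iso hPhi hE) => C EC; first exact: (mp_measure hT EC).1.
(* Conjugacy is given for [Psi]. Taking it at [Phi C] and applying [Phi] yields the intertwining
   relation for [Phi]; cancelling [Phi] against [Psi] requires the preimage of [Phi C] under [S] to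
   lie in the extended ring of [nu]. *)
have FC := sai_sub h EC; have [FS _] := mp_measure hS FC.
by rewrite -{1}(PhiK C EC) -PsiS // (PsiK _ FS).2.
Qed.
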